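(* Consider the complex 3-dimensional Novikov algebras $E_{1,\lambda}(\alpha)$ $(\lambda\in\mathbb{C}\setminus\{0\},\ \alpha\in\mathbb{C})$, $E_{2,\lambda}$ $(\lambda\in\mathbb{C}\setminus\{0\})$, $E_3$, $E_4$, $E_5(\beta)$ $(\beta\in\mathbb{C})$, $E_6$ given by the products listed in the context. Let $A$ and $B$ be algebras from this list whose associated Lie algebras are isomorphic. Then $B$ lies in $\partial O(A)$ if and only if $B$ is isomorphic to one of the algebras given for $A$ below: \begin{itemize} \item $A=E_{1,\lambda}(\alpha)$, $\lambda\neq0$, $\alpha\in\mathbb{C}$: none; \item $A=E_{2,\lambda}$, $\lambda\neq 0$: $E_{1,\lambda}(-1)$; \item $A=E_3$: $E_{1,2}(-1)$, $E_{2,2}$, $E_6$; \item $A=E_4$: $E_{1,\frac12}(-1)$, $E_{2,\frac12}$, $E_5(-1)$; \item $A=E_5(\beta)$ with $\beta\neq-\tfrac12,-1$: $E_{1,\frac12}(\beta)$; \item $A=E_5(-\tfrac12)$: $E_{1,2}(-1)$, $E_6$; \item $A=E_5(-1)$: $E_{1,\frac12}(-1)$; \item $A=E_6$: $E_{1,2}(-1)$. \end{itemize}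
   Context: A Novikov algebra over $\mathbb{C}$ is a complex vector space with a bilinear product satisfying $(x\cdot y)\cdot z-x\cdot(y\cdot z)=(y\cdot x)\cdot z-y\cdot(x\cdot z)$ and $(x\cdot y)\cdot z=(x\cdot z)\cdot y$ for all $x,y,z$; its associated Lie algebra has bracket $[x,y]=x\cdot y-y\cdot x$. Fix a 3-dimensional complex vector space $V$ with basis $(e_1,e_2,e_3)$. The set of Novikov products on $V$, identified with their structure constants in $\mathbb{C}^{27}$, is an affine algebraic set, on which $GL_3(\mathbb{C})$ acts by $(g\circ\mu)(x,y)=g(\mu(g^{-1}x,g^{-1}y))$. For a 3-dimensional Novikov algebra $A$, $O(A)$ is the orbit of a structure representing $A$, $\overline{O(A)}$ its Zariski closure, and $\partial O(A)=\overline{O(A)}\setminus O(A)$; ''$B$ lies in $\partial O(A)$'' means that a structure representing $B$ lies in $\partial O(A)$. The algebras (basis $e_1,e_2,e_3$; products of basis vectors not listed are zero): $E_{1,\lambda}(\alpha)$, $\lambda\neq0$: $e_1e_1=\alpha e_1$, $e_1e_2=(\alpha+1)e_2$, $e_1e_3=(\alpha+\lambda)e_3$, $e_2e_1=\alpha e_2$, $e_3e_1=\alpha e_3$. $E_{2,\lambda}$, $\lambda\neq0$: $e_1e_1=-e_1+e_2$, $e_1e_3=(\lambda-1)e_3$, $e_2e_1=-e_2$, $e_3e_1=-e_3$. $E_3$: $e_1e_1=-\frac12e_1+e_3$, $e_1e_2=\frac12e_2$, $e_1e_3=e_2$, $e_2e_1=-\frac12e_2$, $e_3e_1=e_2-\frac12e_3$.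 $E_4$: $e_1e_1=-e_1+e_2$, $e_1e_3=-\frac12e_3$, $e_2e_1=-e_2$, $e_3e_1=-e_3$, $e_3e_3=e_2$. $E_5(\beta)$: $e_1e_1=\beta e_1$, $e_1e_2=(\beta+1)e_2$, $e_1e_3=(\beta+\frac12)e_3$, $e_2e_1=\beta e_2$, $e_3e_1=\beta e_3$, $e_3e_3=e_2$. $E_6$: $e_1e_1=-\frac12e_1$, $e_1e_2=\frac12e_2$, $e_1e_3=e_2$, $e_2e_1=-\frac12e_2$, $e_3e_1=e_2-\frac12e_3$. The associated Lie algebra of $E_{1,\lambda}(\alpha)$ and $E_{2,\lambda}$ is $\mathfrak{r}_{3,\lambda}(\mathbb{C})$: $[e_1,e_2]=e_2$, $[e_1,e_3]=\lambda e_3$; that of $E_3,E_4,E_5(\beta),E_6$ is $\mathfrak{r}_{3,1/2}(\mathbb{C})$. One has $\mathfrak{r}_{3,\lambda}(\mathbb{C})\cong\mathfrak{r}_{3,\lambda'}(\mathbb{C})$ iff $\lambda'\in\{\lambda,\lambda^{-1}\}$. The only isomorphisms among the listed algebras are $E_{1,\lambda}(\alpha)\cong E_{1,1/\lambda}(\alpha/\lambda)$. *)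

(* Defs.v *)
From mathcomp Require Import all_boot all_order all_algebra.
From mathcomp Require Import classical_sets reals complex mpoly ring.

Set Implicit Arguments.
Unset Strict Implicit.
Unset Printing Implicit Defensive.

Import GRing.Theory.
Local Open Scope classical_set_scope.
Local Open Scope ring_scope.

(* The basis vectors e_1, e_2, e_3 of V = F^3 (column vectors) have the
   indices 0, 1, 2 of 'I_3. *)
Definition basis (F : fieldType) (i : 'I_3) : 'cV[F]_3 := delta_mx i 0.

(* c (i, j, k) is the coefficient of e_k in e_i e_j: a point of F^27. *)
Definition structure (F : fieldType) := {ffun 'I_3 * 'I_3 * 'I_3 -> F}.

Definition product (F : fieldType) (c : structure F) (x y : 'cV[F]_3) :
    'cV[F]_3 :=
  \col_k \sum_(i < 3) \sum_(j < 3) x i 0 * y j 0 * c (i, j, k).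

Definition structure_of (F : fieldType) (m : 'cV[F]_3 -> 'cV[F]_3 -> 'cV[F]_3) :
    structure F :=
  [ffun t => m (basis F t.1.1) (basis F t.1.2) t.2 0].

Definition novikov (F : fieldType) (c : structure F) : Prop :=
  let m := product c in
  (forall x y z, m (m x y) z - m x (m y z) = m (m y x) z - m y (m x z)) /\
  (forall x y z, m (m x y) z = m (m x z) y).

Definition associated_lie (F : fieldType) (c : structure F) : structure F :=
  structure_of (fun x y => product c x y - product c y x).

Definition isomorphic (F : fieldType) (c d : structure F) : Prop :=
  exists2 g : 'M[F]_3, g \in unitmx &
    forall x y, g *m product c x y = product d (g *m x) (g *m y).

Definition act (F : fieldType) (g : 'M[F]_3) (c : structure F) : structure F :=
  structure_of (fun x y => g *m product c (invmx g *m x) (invmx g *m y)).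

Definition orbit (F : fieldType) (c : structure F) : set (structure F) :=
  [set d | exists2 g : 'M[F]_3, g \in unitmx & d = act g c].

(* Polynomial functions in the 27 structure constants; the variables are
   numbered by enum_rank. *)
Definition scpoly (F : fieldType) := {mpoly F[#|{: 'I_3 * 'I_3 * 'I_3}|]}.

Definition eval (F : fieldType) (p : scpoly F) (c : structure F) : F :=
  p.@[fun i => c (enum_val i)].

Definition algebraic_set (F : fieldType) (Z : set (structure F)) : Prop :=
  exists P : set (scpoly F), Z = [set c | forall p, P p -> eval p c = 0].

Lemma novikov_algebraic (F : fieldType) :
  algebraic_set [set c : structure F | novikov c].
Proof.
pose gen (x y : 'I_3 -> scpoly F) (k : 'I_3) : scpoly F :=
  \sum_(i < 3) \sum_(j < 3) x i * y j * 'X_(enum_rank (i, j, k)).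
pose cst (x : 'cV[F]_3) (i : 'I_3) : scpoly F := (x i 0)%:MP.
have subE (u v : 'cV[F]_3) k : (u - v) k 0 = u k 0 - v k 0 by rewrite !mxE.
have eval_gen c x y (u v : 'cV[F]_3) k :
    (forall i, eval (x i) c = u i 0) -> (forall i, eval (y i) c = v i 0) ->
    eval (gen x y k) c = product c u v k 0.
  move=> xu yv; rewrite /eval raddf_sum mxE; apply: eq_bigr => i _.
  rewrite raddf_sum; apply: eq_bigr => j _ /=.
  by rewrite !mevalM mevalXU enum_rankK -xu -yv.
have eval_cst c x i : eval (cst x i) c = x i 0 by rewrite /eval mevalC.
pose asc x y z k := gen (gen x y) z k - gen x (gen y z) k.
have eval_gen2l c x y z k : eval (gen (gen (cst x) (cst y)) (cst z) k) c =
    product c (product c x y) z k 0.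
  by apply: (eval_gen) => // i; apply: (eval_gen).
have eval_gen2r c x y z k : eval (gen (cst x) (gen (cst y) (cst z)) k) c =
    product c x (product c y z) k 0.
  by apply: (eval_gen) => // i; apply: (eval_gen).
have eval_asc c x y z k : eval (asc (cst x) (cst y) (cst z) k) c =
    (product c (product c x y) z - product c x (product c y z)) k 0.
  by rewrite /eval mevalB -!/(eval _ _) eval_gen2l eval_gen2r subE.
exists [set p | exists x y z k,
  p = asc (cst x) (cst y) (cst z) k - asc (cst y) (cst x) (cst z) k \/
  p = gen (gen (cst x) (cst y)) (cst z) k - gen (gen (cst x) (cst z)) (cst y) k].
apply/seteqP; split=> c /= => [[n1 n2] p [x [y [z [k [] ->]]]]|H].
- by rewrite /eval mevalB -!/(eval _ _) !eval_asc n1 subrr.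
- by rewrite /eval mevalB -!/(eval _ _) !eval_gen2l n2 subrr.
split=> x y z; apply/colP => k.
- apply/subr0_eq; rewrite -!eval_asc /eval -mevalB -/(eval _ _).
  by apply: H; exists x, y, z, k; left.
- apply/subr0_eq; rewrite -!eval_gen2l /eval -mevalB -/(eval _ _).
  by apply: H; exists x, y, z, k; right.
Qed.

(* Closure in F^27. The Novikov structures form an algebraic set
   (novikov_algebraic), so for sets of Novikov structures this is also
   the closure inside the variety of Novikov structures. *)
Definition zariski_closure (F : fieldType) (S : set (structure F)) :
    set (structure F) := smallest (@algebraic_set F) S.

Definition boundary (F : fieldType) (c : structure F) : set (structure F) :=
  zariski_closure (orbit c) `\` orbit c.

Definition lies_in_boundary (F : fieldType) (b a : structure F) : Prop :=
  exists2 d : structure F, isomorphic d b & boundary a d.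

Inductive algebra (F : fieldType) : Type :=
| E1 of F & F
| E2 of F
| E3
| E4
| E5 of F
| E6.
Arguments E3 {F}.
Arguments E4 {F}.
Arguments E6 {F}.

(* E1 l a is E_{1,l}(a) and E2 l is E_{2,l}; both require l != 0. *)
Definition listed (F : fieldType) (A : algebra F) : Prop :=
  match A with
  | E1 l _ | E2 l => l != 0
  | _ => True
  end.

(* table A i j is the product e_i e_j, with i and j numbered from 1. *)
Definition table (F : fieldType) (A : algebra F) (i j : nat) : 'cV[F]_3 :=
  let e1 := basis F 0 in
  let e2 := basis F 1 in
  let e3 := basis F 2 in
  match A with
  | E1 l a =>
      match i, j with
      | 1%N, 1%N => a *: e1
      | 1%N, 2%N => (a + 1) *: e2
      | 1%N, 3%N => (a + l) *: e3
      | 2%N, 1%N => a *: e2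
      | 3%N, 1%N => a *: e3
      | _, _ => 0
      end
  | E2 l =>
      match i, j with
      | 1%N, 1%N => - e1 + e2
      | 1%N, 3%N => (l - 1) *: e3
      | 2%N, 1%N => - e2
      | 3%N, 1%N => - e3
      | _, _ => 0
      end
  | E3 =>
      match i, j with
      | 1%N, 1%N => - 2^-1 *: e1 + e3
      | 1%N, 2%N => 2^-1 *: e2
      | 1%N, 3%N => e2
      | 2%N, 1%N => - 2^-1 *: e2
      | 3%N, 1%N => e2 - 2^-1 *: e3
      | _, _ => 0
      end
  | E4 =>
      match i, j with
      | 1%N, 1%N => - e1 + e2
      | 1%N, 3%N => - 2^-1 *: e3
      | 2%N, 1%N => - e2
      | 3%N, 1%N => - e3
      | 3%N, 3%N => e2
      | _, _ => 0
      end
  | E5 b =>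
      match i, j with
      | 1%N, 1%N => b *: e1
      | 1%N, 2%N => (b + 1) *: e2
      | 1%N, 3%N => (b + 2^-1) *: e3
      | 2%N, 1%N => b *: e2
      | 3%N, 1%N => b *: e3
      | 3%N, 3%N => e2
      | _, _ => 0
      end
  | E6 =>
      match i, j with
      | 1%N, 1%N => - 2^-1 *: e1
      | 1%N, 2%N => 2^-1 *: e2
      | 1%N, 3%N => e2
      | 2%N, 1%N => - 2^-1 *: e2
      | 3%N, 1%N => e2 - 2^-1 *: e3
      | _, _ => 0
      end
  end.

Definition str (F : fieldType) (A : algebra F) : structure F :=
  [ffun t : 'I_3 * 'I_3 * 'I_3 => table A t.1.1.+1 t.1.2.+1 t.2 0].

Lemma product_strE (F : fieldType) (A : algebra F) x y :
  let p := product (str A) x y in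
  let x1 := x 0 0 in let x2 := x 1 0 in let x3 := x 2 0 in
  let y1 := y 0 0 in let y2 := y 1 0 in let y3 := y 2 0 in
  (p 0 0, p 1 0, p 2 0) =
  match A with
  | E1 l a => (a * (x1 * y1), (a + 1) * (x1 * y2) + a * (x2 * y1),
               (a + l) * (x1 * y3) + a * (x3 * y1))
  | E2 l => (- (x1 * y1), x1 * y1 - x2 * y1,
             (l - 1) * (x1 * y3) - x3 * y1)
  | E3 => (- 2^-1 * (x1 * y1),
           2^-1 * (x1 * y2 - x2 * y1) + x1 * y3 + x3 * y1,
           x1 * y1 - 2^-1 * (x3 * y1))
  | E4 => (- (x1 * y1), x1 * y1 - x2 * y1 + x3 * y3,
           - 2^-1 * (x1 * y3) - x3 * y1)
  | E5 b => (b * (x1 * y1), (b + 1) * (x1 * y2) + b * (x2 * y1) + x3 * y3,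
             (b + 2^-1) * (x1 * y3) + b * (x3 * y1))
  | E6 => (- 2^-1 * (x1 * y1),
           2^-1 * (x1 * y2 - x2 * y1) + x1 * y3 + x3 * y1,
           - 2^-1 * (x3 * y1))
  end.
Proof.
have E (u v : 'cV[F]_3) k : product (str A) u v k 0 =
    u 0 0 * (v 0 0 * table A 1 1 k 0 + v 1 0 * table A 1 2 k 0
             + v 2 0 * table A 1 3 k 0)
  + u 1 0 * (v 0 0 * table A 2 1 k 0 + v 1 0 * table A 2 2 k 0
             + v 2 0 * table A 2 3 k 0)
  + u 2 0 * (v 0 0 * table A 3 1 k 0 + v 1 0 * table A 3 2 k 0
             + v 2 0 * table A 3 3 k 0).
  rewrite mxE !big_ord_recl !big_ord0 !ffunE /=.
  have -> : lift ord0 ord0 = 1 :> 'I_3 by apply: val_inj.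
  have -> : lift ord0 (lift ord0 ord0) = 2 :> 'I_3 by apply: val_inj.
  rewrite !addr0 !mulrDr !mulrA !addrA //.
move=> p x1 x2 x3 y1 y2 y3.
rewrite /p !E -/x1 -/x2 -/x3 -/y1 -/y2 -/y3; clearbody x1 x2 x3 y1 y2 y3; clear.
by case: A => [l a|l|||b|] /=; rewrite !mxE /=; congr (_, _, _); ring.
Qed.

Lemma str_novikov (F : fieldType) (A : algebra F) :
  2 != 0 :> F -> novikov (str A).
Proof.
move=> two_neq0.
have eq3 (u v : 'cV[F]_3) :
    (u 0 0, u 1 0, u 2 0) = (v 0 0, v 1 0, v 2 0) -> u = v.
  move=> [e0 e1 e2]; apply/colP => k.
  by case: k => [[|[|[|//]]] hk]; [move: e0 | move: e1 | move: e2];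
     congr (_ = _); congr (fun_of_matrix _ _ _); apply: val_inj.
have subE (u v : 'cV[F]_3) k : (u - v) k 0 = u k 0 - v k 0 by rewrite !mxE.
split=> x y z; apply: eq3; rewrite ?subE.
all: case: A => [l a|l|||b|].
all: match goal with |- context [str ?A] =>
  have E0 u v := congr1 (fun t => t.1.1) (product_strE A u v);
  have E1 u v := congr1 (fun t => t.1.2) (product_strE A u v);
  have E2 u v := congr1 (fun t => t.2) (product_strE A u v) end.
all: lazy beta iota zeta delta [fst snd] in E0, E1, E2; rewrite !(E0, E1, E2); congr (_, _, _).
all: by field.
Qed.

Definition degenerations (F : fieldType) (A : algebra F) : seq (algebra F) :=
  match A with
  | E1 _ _ => [::]
  | E2 l => [:: E1 l (- 1)]
  | E3 => [:: E1 2 (- 1); E2 2; E6]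
  | E4 => [:: E1 2^-1 (- 1); E2 2^-1; E5 (- 1)]
  | E5 b => if b == - 2^-1 then [:: E1 2 (- 1); E6]
            else if b == - 1 then [:: E1 2^-1 (- 1)]
            else [:: E1 2^-1 b]
  | E6 => [:: E1 2 (- 1)]
  end.

(* Main.v *)
Require Import Defs.
From mathcomp Require Import all_boot all_order all_algebra.
From mathcomp Require Import reals complex.
From mathcomp Require Import classical_sets mpoly ring.

(** Every listed algebra is E_{1,l}(a) with a commutative product added,
      e1 e1 += p e2 + s e3,   e1 e3, e3 e1 += r e2,   e3 e3 += w e2,
    so that six parameters (a, l, p, r, s, w) describe the whole list
    ([E1plus], [strE]), and every question about it becomes a computation with
    these parameters.

    Degenerations come from polynomial curves t |-> c(t) of structures that are
    isomorphic to A for t != 0: an equation of a closed set containing the orbit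
    restricts to a polynomial in t vanishing for all t != 0, hence also at t = 0
    ([degenerates_curve]).  Rescaling e2 and e3 by powers of t makes chosen
    parameters among p, r, s, w tend to 0 ([degenerates_keep_w] and its
    variants), which gives, up to an exchange of e2 and e3 ([E1plus_swap]), every
    degeneration of the list except E_5(-1/2) -> E_6, where e1 must also be
    moved ([E1plus_shear]).

    Obstructions come from identities between covariants of the product: terms
    built from products, sums and traces of multiplications.  The structures
    satisfying such an identity form a closed set stable under isomorphism, so
    an identity of A is inherited by all its degenerations
    ([degenerates_identity]).  Four kinds of identities suffice.
    - Traces and the characteristic polynomial of ad_x on [A, A] determine
      (a, l) up to the change (a / l, 1 / l), which exchanges e2 and e3
      ([degenerates_type]).
    - Right multiplications are scalar on [A, A] exactly when r = w = 0
      ([derived_scalarP]); this characterizes the families E_1 and E_2.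
    - [A, A] has zero product exactly when w = 0 ([derived_squareP]); this
      excludes E_4 and E_5.
    - The parameters p and s are seen by the component q(x) of x x in [A, A].
      Left multiplication by x has two eigenvalues on [A, A]; asking q(x) to be
      an eigenvector for one of them forbids a component of q(e1) in the other
      eigenspace ([defect_eigen_e1]); this excludes E_2, E_3 and E_4.  For
      E_{1,1}(-1), where the two eigenvalues coincide, q vanishes identically.
    An identity of D that fails in A also shows that A and D are not isomorphic,
    so the same identities prove that each listed degeneration leaves the
    orbit. *)

Set Implicit Arguments.
Unset Strict Implicit.
Unset Printing Implicit Defensive.

(* Several libraries also declare names such as basis and orbit. *)
Import GRing.Theory Num.Theory Defs.
Local Open Scope ring_scope.

(** * Isomorphisms and orbits *)

Section Isomorphism.
Variable F : fieldType.
Implicit Types (c d : structure F) (x y : 'cV[F]_3) (g M N : 'M[F]_3).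

Definition lmulmx c x : 'M[F]_3 := \matrix_(k, j) \sum_i x i 0 * c (i, j, k).
Definition rmulmx c y : 'M[F]_3 := \matrix_(k, i) \sum_j y j 0 * c (i, j, k).

Lemma lmulmxE c x y : product c x y = lmulmx c x *m y.
Proof.
apply/colP=> k; rewrite !mxE exchange_big; apply: eq_bigr => j _.
by rewrite mxE mulr_suml; apply: eq_bigr => i _; rewrite mulrAC.
Qed.

Lemma rmulmxE c x y : product c x y = rmulmx c y *m x.
Proof.
apply/colP=> k; rewrite !mxE; apply: eq_bigr => i _.
by rewrite mxE mulr_suml; apply: eq_bigr => j _; rewrite -mulrA mulrC.
Qed.

Lemma product_basis c i j k :
  product c (basis F i) (basis F j) k 0 = c (i, j, k).
Proof.
rewrite lmulmxE -colE !mxE (bigD1 i) //= big1 => [|i' ne]; rewrite !mxE eqxx.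
  by rewrite mul1r addr0.
by rewrite (negPf ne) mul0r.
Qed.

Lemma structure_inj c d : product c =2 product d -> c = d.
Proof. by move=> e; apply/ffunP => -[[i j] k]; rewrite -!product_basis e. Qed.

Lemma mulmx_inj M N : (forall x, M *m x = N *m x) -> M = N.
Proof.
move=> e; apply/matrixP => i j; have /colP/(_ i) := e (delta_mx j 0).
by rewrite -!colE !mxE.
Qed.

Lemma isomorphic_refl c : isomorphic c c.
Proof. by exists 1%:M => [|x y]; rewrite ?unitmx1 ?mul1mx. Qed.

Lemma isomorphic_sym c d : isomorphic c d -> isomorphic d c.
Proof.
case=> g gu e; exists (invmx g) => [|x y]; first by rewrite unitmx_inv.
by rewrite -{1}(mulKVmx gu x) -{1}(mulKVmx gu y) -e mulKmx.
Qed.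

Lemma isomorphic_trans d c b :
  isomorphic c d -> isomorphic d b -> isomorphic c b.
Proof.
case=> g gu e [h hu e']; exists (h *m g) => [|x y].
  by rewrite unitmx_mul hu.
by rewrite -!mulmxA e e'.
Qed.

(** [act] transports only products of basis vectors; both sides are bilinear. *)
Lemma product_act g c x y :
  product (act g c) x y = g *m product c (invmx g *m x) (invmx g *m y).
Proof.
rewrite lmulmxE [in RHS]lmulmxE !mulmxA; congr (_ *m _).
apply: mulmx_inj => {}y; rewrite -lmulmxE -!mulmxA -lmulmxE.
rewrite rmulmxE [in RHS]rmulmxE !mulmxA.
congr (_ *m _); apply: mulmx_inj => {}x; rewrite -rmulmxE -!mulmxA -rmulmxE.
apply/colP => k; rewrite mxE.
under eq_bigr => i _ do under eq_bigr => j _ do rewrite ffunE /=.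
set f := fun x y => (g *m product c (invmx g *m x) (invmx g *m y)) k 0.
rewrite -[RHS]/(f x y).
have fl y' : f^~ y' =1
    fun x => (g *m rmulmx c (invmx g *m y') *m invmx g *m x) k 0.
  by move=> x'; rewrite /f rmulmxE !mulmxA.
have fr x' : f x' =1
    fun y => (g *m lmulmx c (invmx g *m x') *m invmx g *m y) k 0.
  by move=> y'; rewrite /f lmulmxE !mulmxA.
rewrite fl mxE; apply: eq_bigr => i _; rewrite [RHS]mulrC.
transitivity (x i 0 * f (basis F i) y); last by rewrite fl -colE mxE.
rewrite fr mxE mulr_sumr; apply: eq_bigr => j _.
by rewrite -mulrA; congr (_ * _); rewrite mulrC -[LHS]/(f _ _ * _) fr -colE mxE.
Qed.

Lemma orbitP c d : orbit c d <-> isomorphic c d.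
Proof.
split=> [[g gu ->]|[g gu e]]; exists g => //.
  by move=> x y; rewrite product_act !mulKmx.
by apply: structure_inj => x y; rewrite product_act e !mulKVmx.
Qed.

Lemma mxtrace_conj g M N : g \in unitmx -> g *m M = N *m g -> \tr M = \tr N.
Proof.
move=> gu e; rewrite -[N]mulmx1 -(mulmxV gu) mulmxA -e -mulmxA mxtrace_mulC.
by rewrite -mulmxA mulVmx ?mulmx1.
Qed.

Lemma mxtrace_lmulmx c d g x : g \in unitmx ->
    (forall x y, g *m product c x y = product d (g *m x) (g *m y)) ->
  \tr (lmulmx d (g *m x)) = \tr (lmulmx c x).
Proof.
move=> gu e; apply/esym/(mxtrace_conj gu)/mulmx_inj => y.
by rewrite -!mulmxA -!lmulmxE e.
Qed.

Lemma mxtrace_rmulmx c d g x : g \in unitmx ->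
    (forall x y, g *m product c x y = product d (g *m x) (g *m y)) ->
  \tr (rmulmx d (g *m x)) = \tr (rmulmx c x).
Proof.
move=> gu e; apply/esym/(mxtrace_conj gu)/mulmx_inj => y.
by rewrite -!mulmxA -!rmulmxE e.
Qed.

End Isomorphism.

(** * Identities between covariants *)

(** A syntax for the covariants of a product, so that invariance under
    isomorphism and dependence on the structure constants through polynomials
    are each proved once, by induction on terms.  In TrL u v and TrR u v the
    vector v is multiplied by the trace of left, right multiplication by u. *)
Inductive term (F : Type) :=
| Var of nat
| Mul of term F & term F
| Add of term F & term F
| Scale of F & term F
| TrL of term F & term F
| TrR of term F & term F.
Arguments Var {F}.

Section Identities.
Variable F : fieldType.
Implicit Types (c d : structure F) (t : term F) (e : nat -> 'cV[F]_3).

Fixpoint value c e t : 'cV[F]_3 :=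
  match t with
  | Var n => e n
  | Mul u v => product c (value c e u) (value c e v)
  | Add u v => value c e u + value c e v
  | Scale a u => a *: value c e u
  | TrL u v => \tr (lmulmx c (value c e u)) *: value c e v
  | TrR u v => \tr (rmulmx c (value c e u)) *: value c e v
  end.

Definition identity t c := forall e, value c e t = 0.

Lemma value_iso c d g e t : g \in unitmx ->
    (forall x y, g *m product c x y = product d (g *m x) (g *m y)) ->
  value d (fun n => g *m e n) t = g *m value c e t.
Proof.
move=> gu ge; elim: t => //= [u -> v ->|u -> v ->|a u ->|u -> v ->|u -> v ->].
- by rewrite ge.
- by rewrite mulmxDr.
- by rewrite scalemxAr.
- by rewrite (mxtrace_lmulmx _ gu ge) scalemxAr.
- by rewrite (mxtrace_rmulmx _ gu ge) scalemxAr.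
Qed.

Lemma identity_iso t c d : isomorphic c d -> identity t c -> identity t d.
Proof.
case=> g gu ge tc e; rewrite -(mulKVmx gu (value d e t)).
have /(isomorphic_sym) [h hu he] : isomorphic c d by exists g.
have := value_iso e t hu he; rewrite tc => /esym h0.
by rewrite -[value d e t](mulKmx hu) h0 !mulmx0.
Qed.

(** The vectors e are fixed; only the structure constants vary. *)
Lemma value_poly e t :
  exists P : 'I_3 -> scpoly F, forall c k, eval (P k) c = value c e t k 0.
Proof.
have tensor (P Q : 'I_3 -> scpoly F) i j k c :
    eval (P i * Q j * 'X_(enum_rank (i, j, k))) c
    = eval (P i) c * eval (Q j) c * c (i, j, k).
  by rewrite /eval !mevalM mevalXU enum_rankK.
have evalM (p q : scpoly F) c : eval (p * q) c = eval p c * eval q c.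
  exact: mevalM.
elim: t => [n|u [P uP] v [Q vQ]|u [P uP] v [Q vQ]|a u [P uP]
           |u [P uP] v [Q vQ]|u [P uP] v [Q vQ]] /=.
- by exists (fun k => (e n k 0)%:MP) => c k; rewrite /eval mevalC.
- exists (fun k => \sum_i \sum_j P i * Q j * 'X_(enum_rank (i, j, k))) => c k.
  rewrite mxE [LHS]raddf_sum; apply: eq_bigr => i _.
  rewrite raddf_sum; apply: eq_bigr => j _.
  by rewrite -[LHS]/(eval _ _) tensor uP vQ.
- by exists (fun k => P k + Q k) => c k; rewrite mxE -uP -vQ /eval mevalD.
- by exists (fun k => a%:MP * P k) => c k; rewrite mxE -uP evalM /eval mevalC.
- exists (fun k =>
    (\sum_j \sum_i P i * 1 * 'X_(enum_rank (i, j, j))) * Q k) => c k.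
  rewrite mxE evalM vQ; congr (_ * _).
  rewrite [LHS]raddf_sum; apply: eq_bigr => j _.
  rewrite mxE raddf_sum; apply: eq_bigr => i _.
  by rewrite -[LHS]/(eval _ _) (tensor _ (fun=> 1)) uP /eval meval1 mulr1.
- exists (fun k =>
    (\sum_i \sum_j 1 * P j * 'X_(enum_rank (i, j, i))) * Q k) => c k.
  rewrite mxE evalM vQ; congr (_ * _).
  rewrite [LHS]raddf_sum; apply: eq_bigr => j _.
  rewrite mxE raddf_sum; apply: eq_bigr => i _.
  by rewrite -[LHS]/(eval _ _) (tensor (fun=> 1)) uP /eval meval1 mul1r.
Qed.

(** All polynomials vanishing on the locus are taken as its equations; they
    cut out no more than the locus since they include the coordinates of all
    values of t. *)
Lemma identity_algebraic t : algebraic_set (identity t).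
Proof.
exists [set p | forall c, identity t c -> eval p c = 0]%classic.
apply/seteqP; split=> c /=; first by move=> tc p; exact.
move=> pc e; have [P tP] := value_poly e t; apply/colP => k.
by rewrite -tP pc ?mxE // => d td; rewrite tP td mxE.
Qed.

(** The representative d' of d is arbitrary, as in [lies_in_boundary]; this
    makes the relation invariant under isomorphism in d. *)
Definition degenerates c d :=
  exists2 d', isomorphic d' d & zariski_closure (orbit c) d'.

Lemma degenerates_isor c d d' :
  isomorphic d d' -> degenerates c d -> degenerates c d'.
Proof. by move=> dd' [b bd]; exists b => //; apply: isomorphic_trans dd'. Qed.

Lemma lies_in_boundaryE c d :
  lies_in_boundary d c <-> degenerates c d /\ ~ isomorphic c d.
Proof.
split=> [[d' d'd [cd' ncd']]|[[d' d'd cd'] ncd]].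
  split; first by exists d'.
  by move=> cd; apply/ncd'/orbitP/(isomorphic_trans cd)/isomorphic_sym.
exists d' => //; split=> // /orbitP cd'0.
exact/ncd/(isomorphic_trans cd'0).
Qed.

(** The locus of t is a closed set containing the orbit of c, hence its
    closure. *)
Lemma degenerates_identity t c d :
  degenerates c d -> identity t c -> identity t d.
Proof.
case=> d' d'd cd' tc; apply: (identity_iso d'd).
apply: (cd' (identity t)); split; first exact: identity_algebraic.
by move=> b /orbitP cb; apply: identity_iso tc.
Qed.
End Identities.

(** * Degenerations along curves *)

Section Curves.
Variable F : numFieldType.
Implicit Types c : structure F.

(** In characteristic 0 the nonzero integers are already too many roots. *)
Lemma poly_horner_eq0 (q : {poly F}) : (forall t, t != 0 -> q.[t] = 0) -> q = 0.
Proof.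
move=> q0.
apply: (@roots_geq_poly_eq0 _ _ [seq i.+1%:R | i <- iota 0 (size q)]).
- by apply/allP => _ /mapP[i _ ->]; rewrite rootE q0 // pnatr_eq0.
- by rewrite map_inj_uniq ?iota_uniq // => i j /eqP; rewrite eqr_nat => /eqP[].
- by rewrite size_map size_iota.
Qed.

(** Restricted to the curve, an equation p of a closed set containing the orbit
    becomes a polynomial q in t, which vanishes for t != 0. *)
Lemma degenerates_curve (P : {ffun 'I_3 * 'I_3 * 'I_3 -> {poly F}}) c :
  (forall t, t != 0 -> isomorphic c [ffun i => (P i).[t]]) ->
  degenerates c [ffun i => (P i).[0]].
Proof.
move=> cP; exists [ffun i => (P i).[0]]; first exact: isomorphic_refl.
move=> _ [[Z ->] cZ] p pZ.
pose q : {poly F} := \sum_(m <- msupp p) p@_m *: \prod_i P (enum_val i) ^+ m i.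
have qE t : q.[t] = eval p [ffun i => (P i).[t]].
  rewrite /eval mevalE horner_sum; apply: eq_bigr => m _.
  rewrite hornerZ horner_prod; congr (_ * _); apply: eq_bigr => i _.
  by rewrite horner_exp ffunE.
rewrite -qE (@poly_horner_eq0 q) ?horner0 // => t t0.
by rewrite qE; apply: cZ => //; apply/orbitP/cP.
Qed.
End Curves.

(** * A normal form for all listed algebras *)

(** E_{1,l}(a) plus a commutative product, so the associated Lie algebra is that
    of E_{1,l}(a).  The coefficients live in a ring, not only in a field, so
    that they can be polynomials in the parameter of a curve. *)
Definition E1plus (T : nzRingType) (a l p r s w : T) :
    {ffun 'I_3 * 'I_3 * 'I_3 -> T} :=
  [ffun t => match val t.1.1, val t.1.2, val t.2 with
   | 0, 0, 0 => a
   | 0, 0, 1 => p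
   | 0, 0, 2 => s
   | 0, 1, 1 => (a + 1)%R
   | 0, 2, 1 => r
   | 0, 2, 2 => (a + l)%R
   | 1, 0, 1 => a
   | 2, 0, 1 => r
   | 2, 0, 2 => a
   | 2, 2, 1 => w
   | _, _, _ => 0%R
   end%N].

Definition vec3 (T : Type) (x y z : T) : 'cV[T]_3 :=
  \col_i nth x [:: x; y; z] i.

Section NormalForm.
Variable F : fieldType.
Implicit Types (a l p r s w : F).

Lemma vec3P (v : 'cV[F]_3) : exists x y z, v = vec3 x y z.
Proof.
exists (v 0 0), (v 1 0), (v 2 0); apply/colP => k; rewrite mxE.
by case: k => [[|[|[|//]]] hk] /=; congr (v _ _); apply: val_inj.
Qed.

Lemma vec3_inj (x y z x' y' z' : F) :
  vec3 x y z = vec3 x' y' z' -> [/\ x = x', y = y' & z = z'].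
Proof.
move=> e; split; [have := congr1 (fun v : 'cV_3 => v 0 0) e
  | have := congr1 (fun v : 'cV_3 => v 1 0) e
  | have := congr1 (fun v : 'cV_3 => v 2 0) e]; by rewrite !mxE.
Qed.

Lemma vec3_0 : vec3 0 0 0 = 0 :> 'cV[F]_3.
Proof. by apply/colP => -[[|[|[|//]]] hk]; rewrite !mxE. Qed.

Lemma vec3D (x y z x' y' z' : F) :
  vec3 x y z + vec3 x' y' z' = vec3 (x + x') (y + y') (z + z').
Proof. by apply/colP => -[[|[|[|//]]] hk]; rewrite !mxE. Qed.

Lemma vec3Z (b x y z : F) : b *: vec3 x y z = vec3 (b * x) (b * y) (b * z).
Proof. by apply/colP => -[[|[|[|//]]] hk]; rewrite !mxE. Qed.

Lemma sum3 (f : 'I_3 -> F) : \sum_i f i = f 0 + f 1 + f 2.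
Proof.
rewrite !big_ord_recl big_ord0 addr0 addrA; congr (f _ + f _ + f _);
  exact: val_inj.
Qed.

Lemma E1plus_product a l p r s w x1 x2 x3 y1 y2 y3 :
  product (E1plus a l p r s w) (vec3 x1 x2 x3) (vec3 y1 y2 y3) =
  vec3 (a * (x1 * y1))
       ((a + 1) * (x1 * y2) + a * (x2 * y1)
        + p * (x1 * y1) + r * (x1 * y3 + x3 * y1) + w * (x3 * y3))
       ((a + l) * (x1 * y3) + a * (x3 * y1) + s * (x1 * y1)).
Proof.
apply/colP => -[[|[|[|//]]] hk]; rewrite !mxE !sum3 !mxE !ffunE /=; ring.
Qed.

Lemma E1plus_trL a l p r s w x1 x2 x3 :
  \tr (lmulmx (E1plus a l p r s w) (vec3 x1 x2 x3)) = (3 * a + 1 + l) * x1.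
Proof. rewrite /mxtrace !sum3 !mxE !sum3 !mxE !ffunE /=; ring. Qed.

Lemma E1plus_trR a l p r s w x1 x2 x3 :
  \tr (rmulmx (E1plus a l p r s w) (vec3 x1 x2 x3)) = 3 * a * x1.
Proof. rewrite /mxtrace !sum3 !mxE !sum3 !mxE !ffunE /=; ring. Qed.

End NormalForm.

Definition E1plusE := (E1plus_product, E1plus_trL, E1plus_trR, vec3D, vec3Z).

Definition lie (F : fieldType) (u v : term F) :=
  Add (Mul u v) (Scale (-1) (Mul v u)).

(** * Identities satisfied by the normal forms *)

Section Obstructions.
Variable F : numFieldType.
Implicit Types (a l p r s w : F).
Local Notation x := (Var 0).
Local Notation y := (Var 1).
Local Notation z := (Var 2).
Local Notation u := (Var 3).

Lemma three_neq0 : 3 != 0 :> F. Proof. by rewrite pnatr_eq0. Qed.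

Definition derived_square : term F := Mul (lie x y) (lie z u).

(** As l != 0, the commutators span e2 and e3, whose only nonzero product is
    e3 e3 = w e2. *)
Lemma derived_squareP a l p r s w : l != 0 ->
  identity derived_square (E1plus a l p r s w) <-> w = 0.
Proof.
move=> l0; split=> [|-> e /=].
  move/(_ (nth 0 [:: vec3 1 0 0; vec3 0 0 1; vec3 1 0 0; vec3 0 0 1])) => /=.
  rewrite !E1plusE -vec3_0 => /vec3_inj[_ h _].
  have : w * l ^+ 2 = 0 by rewrite -[RHS]h; ring.
  by move/eqP; rewrite mulf_eq0 expf_eq0 (negPf l0) andbF orbF => /eqP.
have [[x1 [x2 [x3 ->]]] [y1 [y2 [y3 ->]]]] := (vec3P (e 0), vec3P (e 1)).
have [[z1 [z2 [z3 ->]]] [u1 [u2 [u3 ->]]]] := (vec3P (e 2), vec3P (e 3)).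
rewrite !E1plusE -vec3_0; congr vec3; ring.
Qed.

(** The trace of right multiplication by z is 3 a z1, so this says that
    right multiplication by z is the scalar a z1 on commutators. *)
Definition derived_scalar : term F :=
  Add (Scale 3 (Mul (lie x y) z)) (Scale (-1) (TrR z (lie x y))).

(** On the span of e2 and e3, right multiplication by z differs from a z1 by
    e3 |-> (r z1 + w z3) e2. *)
Lemma derived_scalarP a l p r s w : l != 0 ->
  identity derived_scalar (E1plus a l p r s w) <-> r = 0 /\ w = 0.
Proof.
move=> l0; split=> [h|[-> ->] e /=].
  have {}h c1 c3 : 3 * l * (r * c1 + w * c3) = 0.
    have /= := h (nth 0 [:: vec3 1 0 0; vec3 0 0 1; vec3 c1 0 c3]).
    by rewrite !E1plusE -vec3_0 => /vec3_inj[_ <- _]; ring.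
  have {}h c1 c3 : r * c1 + w * c3 = 0.
    apply/eqP; move/eqP: (h c1 c3).
    by rewrite !mulf_eq0 (negPf three_neq0) (negPf l0).
  by have := h 1 0; have := h 0 1; rewrite !mulr0 !mulr1 add0r addr0.
have [[x1 [x2 [x3 ->]]] [y1 [y2 [y3 ->]]]] := (vec3P (e 0), vec3P (e 1)).
have [z1 [z2 [z3 ->]]] := vec3P (e 2).
rewrite !E1plusE -vec3_0; congr vec3; ring.
Qed.

(** The square of x minus a x1 x, up to the factor 3: a vector in the span of
    e2 and e3. *)
Definition square_defect : term F :=
  Add (Scale 3 (Mul x x)) (Scale (-1) (TrR x x)).

Lemma value_square_defect a l p r s w v1 v2 v3 :
  value (E1plus a l p r s w) (fun=> vec3 v1 v2 v3) square_defect =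
  3 *: vec3 0
           ((a + 1) * (v1 * v2) + p * v1 ^+ 2 + 2 * r * (v1 * v3) + w * v3 ^+ 2)
           ((a + l) * (v1 * v3) + s * v1 ^+ 2).
Proof. by rewrite /= !E1plusE; congr vec3; ring. Qed.

(** Left multiplication by x has the eigenvalues (a + 1) x1 and (a + l) x1 on
    the span of e2 and e3.  The identity requires the square defect of x to be
    an eigenvector for the eigenvalue n a x1. *)
Definition defect_eigen (n : F) : term F :=
  Add (Scale 3 (Mul x square_defect)) (Scale (- n) (TrR x square_defect)).

(** The case x = e1, where the square defect is 3 (p e2 + s e3). *)
Lemma defect_eigen_e1 n a l p r s w :
  identity (defect_eigen n) (E1plus a l p r s w) ->
  (a + 1 - n * a) * p + r * s = 0 /\ (a + l - n * a) * s = 0.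
Proof.
have nine_neq0 : 9 != 0 :> F by rewrite pnatr_eq0.
move=> /(_ (fun=> vec3 1 0 0)) /=; rewrite !E1plusE -vec3_0.
move=> /vec3_inj[_ h2 h3].
split; apply/(mulfI nine_neq0); rewrite mulr0; [rewrite -h2|rewrite -h3]; ring.
Qed.

(** For a = -1 the eigenvalues are 0 and (l - 1) x1; the square defect has no
    component along e2. *)
Lemma defect_eigen_E1plus_N1 l :
  identity (defect_eigen (1 - l)) (E1plus (-1) l 0 0 0 0).
Proof.
move=> e /=; have [x1 [x2 [x3 ->]]] := vec3P (e 0).
rewrite !E1plusE -vec3_0; congr vec3; ring.
Qed.

(** Left multiplication by x maps e2 to 0 and e3 to - (x1 / 2) e3 + x3 e2, and
    the square defect is a multiple of the eigenvector x1 e3 - 2 x3 e2. *)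
Lemma defect_eigen_E1plus_w :
  identity (defect_eigen 2^-1) (E1plus (-1) 2^-1 0 0 0 1).
Proof.
move=> e /=; have [x1 [x2 [x3 ->]]] := vec3P (e 0).
rewrite !E1plusE -vec3_0; congr vec3; by field.
Qed.

(** For a = - 1/2 and l = 1/2 the eigenvalues are x1 / 2 and 0; the square
    defect lies along e2, which has the first one. *)
Lemma defect_eigen_E1plus_half r w :
  identity (defect_eigen (-1)) (E1plus (- 2^-1) 2^-1 0 r 0 w).
Proof.
move=> e /=; have [x1 [x2 [x3 ->]]] := vec3P (e 0).
rewrite !E1plusE -vec3_0; congr vec3; by field.
Qed.

(** For a = -1 and l = 1 both eigenvalues are 0, and [defect_eigen] cannot
    detect p; the square defect itself does. *)
Lemma square_defect_e1 a l p r s w :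
  identity square_defect (E1plus a l p r s w) -> p = 0 /\ s = 0.
Proof.
move=> /(_ (fun=> vec3 1 0 0)); rewrite value_square_defect !E1plusE -vec3_0.
move=> /vec3_inj[_ h2 h3].
split; apply/(mulfI three_neq0); rewrite mulr0; [rewrite -h2|rewrite -h3]; ring.
Qed.

Lemma square_defect_E1plus : identity square_defect (E1plus (-1) 1 0 0 0 0).
Proof.
move=> e; rewrite /=; have [x1 [x2 [x3 ->]]] := vec3P (e 0).
rewrite !E1plusE -vec3_0; congr vec3; ring.
Qed.

Definition TrAd (t v : term F) := Add (TrL t v) (Scale (-1) (TrR t v)).

(** Compares tr R_x = 3 a x1 with tr ad_x = (1 + l) x1. *)
Definition trace_ratio a l : term F :=
  Add (Scale (1 + l) (TrR x y)) (Scale (- (3 * a)) (TrAd x y)).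

(** Cayley-Hamilton for ad_x on commutators, where its eigenvalues are x1 and
    l x1, multiplied by (1 + l)^2 in order to write (1 + l) x1 as tr ad_x. *)
Definition ad_charpoly l : term F :=
  let v := lie y z in
  Add (Scale ((1 + l) ^+ 2)
         (Add (lie x (lie x v)) (Scale (-1) (TrAd x (lie x v)))))
      (Scale l (TrAd x (TrAd x v))).

(** The same relation multiplied by 9 a^2, with 3 a x1 written as tr R_x; for
    l = -1, when tr ad_x = 0, it is the one that still sees a. *)
Definition ad_charpoly_trR a l : term F :=
  let v := lie y z in
  Add (Scale (9 * a ^+ 2) (lie x (lie x v)))
      (Add (Scale (- (3 * a * (1 + l))) (TrR x (lie x v)))
           (Scale l (TrR x (TrR x v)))).

Lemma trace_ratio_E1plus a l p r s w :
  identity (trace_ratio a l) (E1plus a l p r s w).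
Proof.
move=> e; rewrite /=; have [x1 [x2 [x3 ->]]] := vec3P (e 0).
have [y1 [y2 [y3 ->]]] := vec3P (e 1).
rewrite !E1plusE -vec3_0; congr vec3; ring.
Qed.

Lemma ad_charpoly_E1plus a l p r s w :
  identity (ad_charpoly l) (E1plus a l p r s w).
Proof.
move=> e; rewrite /=; have [x1 [x2 [x3 ->]]] := vec3P (e 0).
have [[y1 [y2 [y3 ->]]] [z1 [z2 [z3 ->]]]] := (vec3P (e 1), vec3P (e 2)).
rewrite !E1plusE -vec3_0; congr vec3; ring.
Qed.

Lemma ad_charpoly_trR_E1plus a l p r s w :
  identity (ad_charpoly_trR a l) (E1plus a l p r s w).
Proof.
move=> e; rewrite /=; have [x1 [x2 [x3 ->]]] := vec3P (e 0).
have [[y1 [y2 [y3 ->]]] [z1 [z2 [z3 ->]]]] := (vec3P (e 1), vec3P (e 2)).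
rewrite !E1plusE -vec3_0; congr vec3; ring.
Qed.

(** The identities see (1, l, a) through the eigenvalues x1 and l x1 of ad_x and
    the eigenvalue a x1 of R_x, hence up to a common factor and up to the order
    of 1 and l. *)
Lemma degenerates_type a l p r s w a' l' p' r' s' w' : l != 0 ->
    degenerates (E1plus a l p r s w) (E1plus a' l' p' r' s' w') ->
  (a' = a /\ l' = l) \/ (a' = a / l /\ l' = l^-1).
Proof.
move=> l0 deg.
pose e := nth 0 [:: vec3 1 0 0; vec3 1 0 0; vec3 0 1 0] : nat -> 'cV[F]_3.
(* The identities are evaluated at x = y = e1, z = e2, where [e1, e2] = e2. *)
have ratio : (1 + l) * a' = a * (1 + l').
  have /(_ e) /= := degenerates_identity deg (trace_ratio_E1plus a l p r s w).
  rewrite !E1plusE -vec3_0 => /vec3_inj[h _ _];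
  apply/subr0_eq/(mulfI three_neq0).
  by rewrite mulr0 -h; ring.
have h0 : (l' - l) * (1 - l * l') = 0.
  have /(_ e) /= := degenerates_identity deg (ad_charpoly_E1plus a l p r s w).
  by rewrite !E1plusE -vec3_0 => /vec3_inj[_ h _]; rewrite -[RHS]oppr0 -h; ring.
have ch : (a' - a) * (l * a' - a) = 0.
  have nine_neq0 : 9 != 0 :> F by rewrite pnatr_eq0.
  have /(_ e) /= :=
    degenerates_identity deg (ad_charpoly_trR_E1plus a l p r s w).
  rewrite !E1plusE -vec3_0 => /vec3_inj[_ h _]; apply/(mulfI nine_neq0).
  by rewrite mulr0 -h; ring.
(* For l = -1 the factor may be -1, so that a' = - a = a / l. *)
have [lN1|l1] := eqVneq (1 + l) 0.
  have {}lN1 : l = -1 by apply/eqP; rewrite -addr_eq0 addrC lN1.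
  have l'E : l' = -1.
    move/eqP: h0; rewrite lN1 mulf_eq0 mulN1r !opprK.
    by rewrite (addrC 1) orbb addr_eq0 => /eqP.
  move/eqP: ch; rewrite lN1 l'E invrN1 mulrN1 mulf_eq0 subr_eq0 mulN1r.
  case/orP=> [/eqP->|]; first by left.
  by rewrite subr_eq0 => /eqP <-; right; rewrite opprK.
move/eqP: h0; rewrite mulf_eq0 !subr_eq0 => /orP[/eqP l'E|/eqP ll'].
  by left; split=> //; apply: (mulfI l1); rewrite ratio l'E mulrC.
have l'E : l' = l^-1 by apply: (mulfI l0); rewrite -ll' mulfV.
right; split=> //; apply: (mulfI l1); rewrite ratio l'E; field.
exact: l0.
Qed.

End Obstructions.
Arguments derived_scalar {F}.
Arguments derived_square {F}.

(** * Isomorphisms and degenerations of normal forms *)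

Section Classification.
Variable F : numFieldType.
Implicit Types (a l p r s w : F) (A B D : algebra F).

(** The matrix with columns u, v, w, that is the images of e1, e2, e3. *)
Definition mat3 (u v w : 'cV[F]_3) : 'M[F]_3 :=
  \matrix_(i, j) nth u [:: u; v; w] j i 0.

Lemma mat3_mul (u v w : 'cV[F]_3) x y z :
  mat3 u v w *m vec3 x y z = x *: u + y *: v + z *: w.
Proof.
apply/colP => k; rewrite !mxE sum3 !mxE /=.
by rewrite !(mulrC _ (u _ _)) !(mulrC _ (v _ _)) !(mulrC _ (w _ _)).
Qed.

(** Reduces an isomorphism to identities between coordinates; h stands for the
    inverse of g. *)
Lemma isomorphic_vec3 (c d : structure F) (g h : 'M[F]_3) :
    (forall x1 x2 x3, h *m (g *m vec3 x1 x2 x3) = vec3 x1 x2 x3) ->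
    (forall x1 x2 x3 y1 y2 y3,
      g *m product c (vec3 x1 x2 x3) (vec3 y1 y2 y3) =
      product d (g *m vec3 x1 x2 x3) (g *m vec3 y1 y2 y3)) ->
  isomorphic c d.
Proof.
move=> hg ge; exists g => [|x y].
  have /mulmx1_unit[//] : h *m g = 1%:M.
  apply: mulmx_inj => v; have [x [y [z ->]]] := vec3P v.
  by rewrite -mulmxA hg mul1mx.
have [[x1 [x2 [x3 ->]]] [y1 [y2 [y3 ->]]]] := (vec3P x, vec3P y).
exact: ge.
Qed.

(** The change of basis e2 |-> e2 / m, e3 |-> e3 / n. *)
Lemma E1plus_scale m n a l p r s w : m != 0 -> n != 0 ->
  isomorphic (F := F) (E1plus a l p r s w)
             (E1plus a l (m * p) (m / n * r) (n * s) (m / n ^+ 2 * w)).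
Proof.
move=> m0 n0.
pose g u v := mat3 (vec3 1 0 0) (vec3 0 u 0) (vec3 0 0 v).
apply: (@isomorphic_vec3 _ _ (g m n) (g m^-1 n^-1))
  => [x1 x2 x3|x1 x2 x3 y1 y2 y3].
  by rewrite /g !(mat3_mul, E1plusE); congr vec3; field.
by rewrite /g !(mat3_mul, E1plusE); congr vec3; field.
Qed.

(** The change of basis e1 |-> e1 / l, e2 |-> e3 / l^2, e3 |-> e2 / l^2, which
    makes the former eigenvalue l of ad e1 equal to 1. *)
Lemma E1plus_swap a l p s : l != 0 ->
  isomorphic (F := F) (E1plus a l p 0 s 0) (E1plus (a / l) l^-1 s 0 p 0).
Proof.
move=> l0.
pose g u := mat3 (vec3 u 0 0) (vec3 0 0 (u ^+ 2)) (vec3 0 (u ^+ 2) 0).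
apply: (@isomorphic_vec3 _ _ (g l) (g l^-1)) => [x1 x2 x3|x1 x2 x3 y1 y2 y3].
  by rewrite /g !(mat3_mul, E1plusE); congr vec3; field.
by rewrite /g !(mat3_mul, E1plusE); congr vec3; field.
Qed.

(** In E_5(- 1/2), replacing e1 by e1 + u e3 creates e1 e3 = u e2 and
    e3 e1 = u e2 - e3 / 2 without changing the rest, except for a term u^2 e2 in
    e1 e1, which adding - 2 u^2 e2 to e1 cancels.  With u = 1/t and u e2 as new
    e2, this gives r = 1 and w = t. *)
Lemma E1plus_shear t : t != 0 ->
  isomorphic (F := F) (E1plus (- 2^-1) 2^-1 0 0 0 1)
    (E1plus (- 2^-1) 2^-1 0 1 0 t).
Proof.
move=> t0; apply: isomorphic_sym.
pose g := mat3 (vec3 1 (- 2 * t ^- 2) t^-1) (vec3 0 t^-1 0) (vec3 0 0 1).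
pose h := mat3 (vec3 1 (2 * t^-1) (- t^-1)) (vec3 0 t 0) (vec3 0 0 1).
apply: (@isomorphic_vec3 _ _ g h) => [x1 x2 x3|x1 x2 x3 y1 y2 y3].
  by rewrite /g /h !(mat3_mul, E1plusE); congr vec3; field.
by rewrite /g !(mat3_mul, E1plusE); congr vec3; field; rewrite ?t0 ?pnatr_eq0.
Qed.

(** The curve of normal forms is the normal form over the polynomial ring. *)
Lemma degenerates_E1plus c a l (P R S W : {poly F}) :
  (forall t, t != 0 -> isomorphic c (E1plus a l P.[t] R.[t] S.[t] W.[t])) ->
  degenerates c (E1plus a l P.[0] R.[0] S.[0] W.[0]).
Proof.
move=> cP.
have hornerE1plus t : [ffun i => (E1plus a%:P l%:P P R S W i).[t]]
            = E1plus a l P.[t] R.[t] S.[t] W.[t].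
  apply/ffunP => -[[i j] k]; rewrite !ffunE /=.
  case: i j k => [[|[|[|i]]] hi] [[|[|[|j]]] hj] [[|[|[|k]]] hk] //=;
    by rewrite ?hornerE.
by rewrite -hornerE1plus; apply: degenerates_curve => t t0;
  rewrite hornerE1plus; apply: cP.
Qed.

(** The scaling m = t^2, n = t multiplies p, r, s, w by t^2, t, t, 1. *)
Lemma degenerates_keep_w a l p r s w :
  degenerates (F := F) (E1plus a l p r s w) (E1plus a l 0 0 0 w).
Proof.
have := @degenerates_E1plus (E1plus a l p r s w) a l
  ('X^2 * p%:P) ('X * r%:P) ('X * s%:P) w%:P.
rewrite !hornerE ?expr0n ?mul0r; apply=> t t0.
have -> : E1plus a l ('X^2 * p%:P).[t] ('X * r%:P).[t] ('X * s%:P).[t]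
                     (w%:P).[t] =
    E1plus a l (t ^+ 2 * p) (t ^+ 2 / t * r) (t * s) (t ^+ 2 / t ^+ 2 * w).
  by rewrite !hornerE; congr E1plus; field.
by apply: E1plus_scale; rewrite ?expf_neq0.
Qed.

(** The scaling m = t, n = 1 multiplies p, r, s, w by t, t, 1, t. *)
Lemma degenerates_keep_s a l p r s w :
  degenerates (F := F) (E1plus a l p r s w) (E1plus a l 0 0 s 0).
Proof.
have := @degenerates_E1plus (E1plus a l p r s w) a l
  ('X * p%:P) ('X * r%:P) s%:P ('X * w%:P).
rewrite !hornerE ?expr0n ?mul0r; apply=> t t0.
have -> : E1plus a l ('X * p%:P).[t] ('X * r%:P).[t] (s%:P).[t] ('X * w%:P).[t]
  = E1plus a l (t * p) (t / 1 * r) (1 * s) (t / 1 ^+ 2 * w).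
  by rewrite !hornerE; congr E1plus; field.
by apply: E1plus_scale; rewrite ?oner_neq0.
Qed.

(** The scaling m = n = t multiplies p, r, s by t, 1, t. *)
Lemma degenerates_keep_r a l p r s :
  degenerates (F := F) (E1plus a l p r s 0) (E1plus a l 0 r 0 0).
Proof.
have := @degenerates_E1plus (E1plus a l p r s 0) a l
  ('X * p%:P) r%:P ('X * s%:P) 0%:P.
rewrite !hornerE ?expr0n ?mul0r; apply=> t t0.
have -> : E1plus a l ('X * p%:P).[t] (r%:P).[t] ('X * s%:P).[t] (0%:P).[t]
  = E1plus a l (t * p) (t / t * r) (t * s) (t / t ^+ 2 * 0).
  by rewrite !hornerE; congr E1plus; field.
exact: E1plus_scale.
Qed.

(** The scaling m = 1, n = 1/t multiplies p, r, w by 1, t, t^2. *)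
Lemma degenerates_keep_p a l p r w :
  degenerates (F := F) (E1plus a l p r 0 w) (E1plus a l p 0 0 0).
Proof.
have := @degenerates_E1plus (E1plus a l p r 0 w) a l
  p%:P ('X * r%:P) 0%:P ('X^2 * w%:P).
rewrite !hornerE ?expr0n ?mul0r; apply=> t t0.
have -> : E1plus a l (p%:P).[t] ('X * r%:P).[t] (0%:P).[t] ('X^2 * w%:P).[t]
  = E1plus a l (1 * p) (1 / t^-1 * r) (t^-1 * 0) (1 / t^-1 ^+ 2 * w).
  by rewrite !hornerE; congr E1plus; field.
by apply: E1plus_scale; rewrite ?invr_eq0 ?oner_neq0.
Qed.

Lemma degenerates_shear :
  degenerates (F := F) (E1plus (- 2^-1) 2^-1 0 0 0 1)
    (E1plus (- 2^-1) 2^-1 0 1 0 0).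
Proof.
have := @degenerates_E1plus (E1plus (- 2^-1) 2^-1 0 0 0 1)
  (- 2^-1) 2^-1 0 1 0 'X.
by rewrite !hornerE; apply=> t t0; rewrite !hornerE; apply: E1plus_shear.
Qed.

Lemma E1plus_type_iso a l a' l' : l != 0 ->
    (a' = a /\ l' = l) \/ (a' = a / l /\ l' = l^-1) ->
  isomorphic (F := F) (E1plus a l 0 0 0 0) (E1plus a' l' 0 0 0 0).
Proof.
move=> l0 [[-> ->]|[-> ->]]; first exact: isomorphic_refl.
exact: E1plus_swap.
Qed.

(** * The listed algebras *)

Definition E1plus_of (A : algebra F) : structure F :=
  match A with
  | E1 l a => E1plus a l 0 0 0 0
  | E2 l => E1plus (-1) l 1 0 0 0
  | E3 => E1plus (- 2^-1) 2^-1 0 1 1 0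
  | E4 => E1plus (-1) 2^-1 1 0 0 1
  | E5 b => E1plus b 2^-1 0 0 0 1
  | E6 => E1plus (- 2^-1) 2^-1 0 1 0 0
  end.

Lemma strE A : str A = E1plus_of A.
Proof.
apply: structure_inj => x y; have := product_strE A x y.
have [[x1 [x2 [x3 ->]]] [y1 [y2 [y3 ->]]]] := (vec3P x, vec3P y).
have [p1 [p2 [p3 ->]]] :=
  vec3P (product (str A) (vec3 x1 x2 x3) (vec3 y1 y2 y3)).
rewrite /= !mxE /=; case: A => [l a|l|||b|] [-> -> ->];
  rewrite !E1plusE; congr vec3; try ring; by field.
Qed.

Lemma half_neq_two : 2^-1 <> 2 :> F.
Proof.
move=> /(congr1 (fun t => 2 * t)); rewrite mulfV ?pnatr_eq0 // -natrM.
by move/esym/eqP; rewrite pnatr_eq1.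
Qed.

Lemma Nhalf_neqN1 : - 2^-1 <> -1 :> F.
Proof.
move=> /oppr_inj /(congr1 (fun t => 2 * t)); rewrite mulfV ?pnatr_eq0 // mulr1.
by move/esym/eqP; rewrite pnatr_eq1.
Qed.

Lemma N2_neqN1 : -1 * 2 <> -1 :> F.
Proof. by rewrite mulN1r => /oppr_inj/eqP; rewrite pnatr_eq1. Qed.

Lemma half_neq0 : 2^-1 != 0 :> F.
Proof. by rewrite invr_eq0 pnatr_eq0. Qed.

Lemma Nhalf_mul2 : - 2^-1 * 2 = -1 :> F.
Proof. by rewrite mulNr mulVf ?pnatr_eq0. Qed.

(** Curves from E_3, E_5(- 1/2) or E_6 end at the first of these algebras, which
    the list names as the second. *)
Lemma E1_half_two :
  isomorphic (str (E1 2^-1 (- 2^-1) : algebra F)) (str (E1 2 (-1))).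
Proof.
rewrite !strE; apply: E1plus_type_iso half_neq0 _; right.
by rewrite invrK Nhalf_mul2.
Qed.

(** The parameter a of the normal form. *)
Definition right_eigen A : F :=
  match A with
  | E1 _ a => a
  | E2 _ | E4 => -1
  | E5 b => b
  | E3 | E6 => - 2^-1
  end.

(** The parameter l of the normal form. *)
Definition lie_param A : F :=
  match A with
  | E1 l _ | E2 l => l
  | _ => 2^-1
  end.

Lemma degenerates_type_str A B : listed A -> degenerates (str A) (str B) ->
  (right_eigen B = right_eigen A /\ lie_param B = lie_param A) \/
  (right_eigen B = right_eigen A / lie_param A /\
   lie_param B = (lie_param A)^-1).
Proof.
move=> hA; rewrite !strE => AB.
have lA : lie_param A != 0 by case: A hA {AB} => //= *; exact: half_neq0.
by case: A B AB lA {hA} => [l a|l|||b|] [l' a'|l'|||b'|] /= AB lA;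
  apply: degenerates_type AB.
Qed.

Definition scalar_on_derived A :=
  match A with E1 _ _ | E2 _ => True | _ => False end.
Definition null_on_derived A :=
  match A with E4 | E5 _ => False | _ => True end.

Lemma derived_scalar_str A : listed A ->
  identity derived_scalar (str A) <-> scalar_on_derived A.
Proof.
have [h n1] := (half_neq0, @oner_neq0 F); rewrite strE.
case: A => [l a|l|||b|] hA /=; rewrite derived_scalarP //;
  split=> //; case=> //;
  by move=> /eqP; rewrite ?(negPf n1) // => _ /eqP; rewrite (negPf n1).
Qed.

Lemma derived_square_str A : listed A ->
  identity derived_square (str A) <-> null_on_derived A.
Proof.
have [h n1] := (half_neq0, @oner_neq0 F); rewrite strE.
by case: A => [l a|l|||b|] hA /=; rewrite derived_squareP //; split=> // /eqP;
  rewrite (negPf n1).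
Qed.

(** The types force E_{1,l}(a) to be isomorphic to E_{1,l'}(-1).  Its square
    defect lies in the eigenspace of l' - 1, that of E_{2,l'} has a component
    along e2, of eigenvalue 0; for l' = 1 the former is zero. *)
Lemma E1_not_degenerates_E2 (l l' a : F) : l != 0 ->
  ~ degenerates (str (E1 l a)) (str (E2 l')).
Proof.
move=> l0 AB; have ty := degenerates_type_str (l0 : listed (E1 l a)) AB.
move: AB ty; rewrite !strE /= => AB /(E1plus_type_iso l0) /isomorphic_sym AE.
have /(degenerates_identity AB)/defect_eigen_e1 :=
  identity_iso AE (@defect_eigen_E1plus_N1 F l').
rewrite addNr mulrN1 opprK add0r mulr1 mulr0 addr0 => -[/eqP].
rewrite subr_eq0 eq_sym => /eqP l'1 _; rewrite l'1 in AB AE.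
have /(degenerates_identity AB)/square_defect_e1[/eqP] :=
  identity_iso AE (@square_defect_E1plus F).
by rewrite oner_eq0.
Qed.

Lemma not_defect_E4 : ~ identity (defect_eigen 2^-1) (str (E4 : algebra F)).
Proof.
rewrite strE => /defect_eigen_e1[/eqP]; rewrite addNr mulrN1 opprK add0r mulr1.
by rewrite mulr0 addr0 (negPf half_neq0).
Qed.

Lemma not_defect_half_E2 l :
  ~ identity (defect_eigen 2^-1) (str (E2 l : algebra F)).
Proof.
rewrite strE => /defect_eigen_e1[/eqP]; rewrite addNr mulrN1 opprK add0r mulr1.
by rewrite mulr0 addr0 (negPf half_neq0).
Qed.

Lemma not_defect_N1_E2 l :
  ~ identity (defect_eigen (-1)) (str (E2 l : algebra F)).
Proof.
rewrite strE => /defect_eigen_e1[/eqP]; rewrite addNr mulrNN mulr1 mulr1.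
by rewrite mulr0 addr0 sub0r oppr_eq0 oner_eq0.
Qed.

Lemma not_defect_N1_E3 : ~ identity (defect_eigen (-1)) (str (E3 : algebra F)).
Proof.
rewrite strE => /defect_eigen_e1[_ /eqP].
by rewrite addNr mulrNN mul1r mulr1 sub0r oppr_eq0 (negPf half_neq0).
Qed.

Lemma defect_half_E5_N1 :
  identity (defect_eigen 2^-1) (str (E5 (-1) : algebra F)).
Proof. by rewrite strE; apply: defect_eigen_E1plus_w. Qed.

Lemma defect_N1_E5_Nhalf :
  identity (defect_eigen (-1)) (str (E5 (- 2^-1) : algebra F)).
Proof. by rewrite strE; apply: defect_eigen_E1plus_half. Qed.

Lemma defect_N1_E6 : identity (defect_eigen (-1)) (str (E6 : algebra F)).
Proof. by rewrite strE; apply: defect_eigen_E1plus_half. Qed.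

Lemma degenerates_scalar_on_derived A B : listed A -> listed B ->
  degenerates (str A) (str B) -> scalar_on_derived A -> scalar_on_derived B.
Proof.
move=> hA hB AB /(derived_scalar_str hA)/(degenerates_identity AB).
by move/(derived_scalar_str hB).
Qed.

Lemma degenerates_null_on_derived A B : listed A -> listed B ->
  degenerates (str A) (str B) -> null_on_derived A -> null_on_derived B.
Proof.
move=> hA hB AB /(derived_square_str hA)/(degenerates_identity AB).
by move/(derived_square_str hB).
Qed.

(** The types leave few candidates B for each A.  Those outside the list are
    excluded by the identities of A: scalarity on commutators for E_1 and E_2,
    zero product of commutators for E_3 and E_6, the square defect for E_1,
    E_5(-1), E_5(- 1/2) and E_6. *)
Lemma degenerates_in_list A B : listed A -> listed B ->
    degenerates (str A) (str B) ->
  isomorphic (str A) (str B) \/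
  exists2 D, List.In D (degenerations A) & isomorphic (str B) (str D).
Proof.
move=> hA hB AB.
have N2 := @N2_neqN1; have h2 := half_neq_two; have N1 := @Nhalf_neqN1.
have ty := degenerates_type_str hA AB.
have act := degenerates_scalar_on_derived hA hB AB.
have sq := degenerates_null_on_derived hA hB AB.
have id n := @degenerates_identity F (defect_eigen n) _ _ AB.
have E1E1 (l a l' a' : F) : l != 0 ->
    a' = a /\ l' = l \/ a' = a / l /\ l' = l^-1 ->
    isomorphic (str (E1 l' a')) (str (E1 l a)).
  by move=> l0 /(E1plus_type_iso l0) /isomorphic_sym; rewrite !strE.
have E1h := isomorphic_trans (E1E1 _ _ _ _ half_neq0 _) E1_half_two.
case: A hA AB ty act sq id => [l a|l|||b|] /= hA AB ty act sq id.
- have {act sq id} actB := act I.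
  case: B hB AB ty actB => //= [l' a'|l'] hB AB ty _.
    by left; apply/isomorphic_sym/E1E1.
  by case: (E1_not_degenerates_E2 hA AB).
- have {act sq id} actB := act I.
  case: B hB AB ty actB => //= [l' a'|l'] hB AB ty _.
    by right; exists (E1 l (-1)); [left|apply: E1E1].
  suff -> : l' = l by left; apply: isomorphic_refl.
  case: ty => [[]|[/eqP h ->]] //.
  have/eqP -> : l == 1 by move: h; rewrite mulN1r eqr_opp eq_sym invr_eq1.
  by rewrite invr1.
- rewrite !invrK Nhalf_mul2 in ty.
  have {act sq id} sqB := sq I.
  case: B hB AB ty sqB => [l' a'|l'|||b'|] /= hB AB ty // _.
  + right; exists (E1 2 (-1)); first by left.
    by apply: E1h; rewrite invrK Nhalf_mul2.
  + right; exists (E2 2); first by right; left.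
    by case: ty => [[/esym/N1]//|[_ ->]]; apply: isomorphic_refl.
  + by left; apply: isomorphic_refl.
  + by right; exists E6; [right; right; left|apply: isomorphic_refl].
- rewrite !invrK in ty.
  clear act sq id; case: B hB AB ty => [l' a'|l'|||b'|] /= hB AB ty //.
  + right; exists (E1 2^-1 (-1)); first by left.
    by apply: E1E1; rewrite ?invrK // half_neq0.
  + right; exists (E2 2^-1); first by right; left.
    by case: ty => [[_ ->]|[/esym/N2]//]; apply: isomorphic_refl.
  + by case: ty => [[/N1]|[_ /h2]].
  + by left; apply: isomorphic_refl.
  + right; exists (E5 (-1)); first by right; right; left.
    by case: ty => [[-> _]|[_ /h2]//]; apply: isomorphic_refl.
  + by case: ty => [[/N1]|[_ /h2]].
- rewrite !invrK in ty.
  clear act sq; case: B hB AB ty id => [l' a'|l'|||b'|] /= hB AB ty id //.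
  + right; rewrite /=; case: eqP => [bE|_].
      rewrite bE in ty; exists (E1 2 (-1)); first by left.
      by apply: E1h; rewrite invrK.
    case: eqP => [bE|_].
      rewrite bE in ty; exists (E1 2^-1 (-1)); first by left.
      by apply: E1E1; rewrite ?invrK // half_neq0.
    exists (E1 2^-1 b); first by left.
    by apply: E1E1; rewrite ?invrK // half_neq0.
  + case: ty => [[bE _]|[bE _]].
      case: (@not_defect_half_E2 l'); apply: id; rewrite -bE.
      exact: defect_half_E5_N1.
    case: (@not_defect_N1_E2 l'); apply: id.
    have -> : b = - 2^-1.
      apply: (mulIf (_ : 2 != 0 :> F)); first by rewrite pnatr_eq0.
      by rewrite -bE Nhalf_mul2.
    exact: defect_N1_E5_Nhalf.
  + case: ty => [[bE _]|[_ /h2]//].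
    case: not_defect_N1_E3; apply: id; rewrite -bE.
    exact: defect_N1_E5_Nhalf.
  + case: ty => [[bE _]|[_ /h2]//].
    by case: not_defect_E4; apply: id; rewrite -bE; apply: defect_half_E5_N1.
  + by case: ty => [[-> _]|[_ /h2]//]; left; apply: isomorphic_refl.
  + case: ty => [[bE _]|[_ /h2]//]; right.
    exists E6; last exact: isomorphic_refl.
    by rewrite /= bE eqxx; right; left.
- rewrite !invrK Nhalf_mul2 in ty.
  have {act sq} sqB := sq I.
  case: B hB AB ty sqB id => [l' a'|l'|||b'|] /= hB AB ty // _ id.
  + right; exists (E1 2 (-1)); first by left.
    by apply: E1h; rewrite invrK Nhalf_mul2.
  + by case: (@not_defect_N1_E2 l'); apply: id defect_N1_E6.
  + by case: not_defect_N1_E3; apply: id defect_N1_E6.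
  + by left; apply: isomorphic_refl.
Qed.

Lemma isomorphic_degenerates (c d : structure F) :
  isomorphic c d -> degenerates c d.
Proof.
move=> cd; exists c => // Z [_]; apply; apply/orbitP/isomorphic_refl.
Qed.

(** The obstructions also give the non-isomorphisms, since isomorphic structures
    degenerate to each other. *)
Lemma in_list_degenerates A D : listed A -> List.In D (degenerations A) ->
  degenerates (str A) (str D) /\ ~ isomorphic (str A) (str D).
Proof.
have n2 : 2 != 0 :> F by rewrite pnatr_eq0.
have h0 := half_neq0.
have toE12 (c : structure F) : degenerates c (str (E1 2^-1 (- 2^-1))) ->
  degenerates c (str (E1 2 (-1))) by apply/degenerates_isor/E1_half_two.
have toE1E5 (b : F) : degenerates (str (E5 b)) (str (E1 2^-1 b)).
  by rewrite !strE; apply: degenerates_keep_s.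
move=> hA DA.
have act : listed D -> isomorphic (str A) (str D) ->
    scalar_on_derived D -> scalar_on_derived A.
  move=> hD /isomorphic_sym/isomorphic_degenerates.
  exact: degenerates_scalar_on_derived.
have sq : listed D -> isomorphic (str A) (str D) ->
    null_on_derived D -> null_on_derived A.
  move=> hD /isomorphic_sym/isomorphic_degenerates.
  exact: degenerates_null_on_derived.
have defect n : isomorphic (str A) (str D) ->
    identity (defect_eigen n) (str D) ->
    identity (defect_eigen n) (str A).
  by move=> /isomorphic_sym; apply: identity_iso.
case: A hA DA act sq defect => [l a|l|||b|] hA //=.
- case=> // <- act sq defect; split.
    by rewrite !strE; apply: degenerates_keep_w.
  move=> /isomorphic_sym/isomorphic_degenerates.
  exact: E1_not_degenerates_E2.
- case=> [|[|[|//]]] <- act sq defect.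
  + split; last by move=> AD; apply: act AD _.
    by apply: toE12; rewrite !strE; apply: degenerates_keep_w.
  + split; last by move=> AD; apply: act AD _.
    rewrite !strE; apply: degenerates_isor (degenerates_keep_s _ _ _ _ _ _).
    by have := E1plus_swap (- 2^-1) 0 1 h0; rewrite invrK Nhalf_mul2.
  + split; first by rewrite !strE; apply: degenerates_keep_r.
    by move=> /defect/(_ defect_N1_E6); apply: not_defect_N1_E3.
- case=> [|[|[|//]]] <- act sq defect.
  + split; last by move=> AD; apply: act AD _.
    by rewrite !strE; apply: degenerates_keep_s.
  + split; last by move=> AD; apply: act AD _.
    by rewrite !strE; apply: degenerates_keep_p.
  + split; first by rewrite !strE; apply: degenerates_keep_w.
    by move=> /defect/(_ defect_half_E5_N1); apply: not_defect_E4.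
- case: eqP => [->|_]; last case: eqP => [->|_].
  + case=> [|[|//]] <- act sq defect; split.
    * exact: toE12.
    * by move=> AD; apply: act AD _.
    * by rewrite !strE; apply: degenerates_shear.
    * by move=> AD; apply: sq AD _.
  + by case=> // <- act sq defect; split=> // AD; apply: act AD _.
  + by case=> // <- act sq defect; split=> // AD; apply: act AD _.
- case=> // <- act sq defect; split; last by move=> AD; apply: act AD _.
  by apply: toE12; rewrite !strE; apply: degenerates_keep_w.
Qed.
End Classification.

Theorem proposition4p5 (R : realType) (A B : algebra R[i]) :
  listed A -> listed B ->
  isomorphic (associated_lie (str A)) (associated_lie (str B)) ->
  lies_in_boundary (str B) (str A) <->
  exists2 D : algebra R[i], List.In D (degenerations A) &
    isomorphic (str B) (str D).
Proof.
move=> hA hB _; rewrite lies_in_boundaryE; split=> [[AB nAB]|[D DA BD]].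
  by case: (degenerates_in_list hA hB AB).
have [AD nAD] := in_list_degenerates hA DA; split.
  exact/(degenerates_isor _ AD)/isomorphic_sym.
by move=> AB; apply/nAD/(isomorphic_trans AB).
Qed.
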